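(* Let $f(x)$ be a random polynomial from $\mathcal P_{d,K}$ with independent and uniformly distributed coefficients. Then $\mathbb P(f(x)\text{ is irreducible})\to1$ as $d$ and $K\to\infty$, as long as $$d\le \log_2(K)-\log_2\left(1+(\log K)^2\right).$$
   Context: For $d,K\in\mathbb N$, $\mathcal P_{d,K}$ is the set of polynomials $f(x)=x^d+a_{d-1}x^{d-1}+\dots+a_1x+a_0$ with $a_0\neq 0$ and $a_i\in[-K,K]\cap\mathbb Z$ for all $0\le i\le d-1$. ''Independent and uniformly distributed coefficients'' means that $a_0,\dots,a_{d-1}$ are independent, each uniform on its set of allowed values (equivalently, $f$ is uniform on $\mathcal P_{d,K}$). A polynomial with integer coefficients is irreducible if it cannot be written as the product of at least two polynomials of smaller degrees with integer coefficients. $\log$ is the natural logarithm. *)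

(* Defs.v *)
From HB Require Import structures.
From mathcomp Require Import all_boot all_order all_algebra.
From mathcomp Require Import finmap.
From mathcomp Require Import all_classical all_reals all_analysis.
Set Implicit Arguments.
Unset Strict Implicit.
Unset Printing Implicit Defensive.
Import Order.TTheory GRing.Theory Num.Theory.
Import numFieldNormedType.Exports.
Local Open Scope classical_set_scope.
Local Open Scope ring_scope.

Definition calP (d K : nat) : set {poly int} :=
  [set f | [/\ f \is monic, size f = d.+1, f`_0 != 0 &
    forall i, (i < d)%N -> - K%:Z <= f`_i <= K%:Z]].

(* The factors range over {poly int} and must all have degree < deg f, so that
   splitting off a constant factor does not make f reducible. *)
Definition int_irreducible (f : {poly int}) : Prop :=
  ~ exists s : seq {poly int},
      [/\ (2 <= size s)%N,
          forall g, g \in s -> (size g < size f)%N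
        & f = \prod_(g <- s) g].

(* Probability of the event B for the uniform law on a finite set A; [fset_set]
   is meaningful only on finite sets. *)
Definition uniform_Pr (R : realType) (T : choiceType) (A B : set T) : R :=
  #|` fset_set (A `&` B)|%:R / #|` fset_set A|%:R.

Lemma finite_calP (d K : nat) : finite_set (calP d K).
Proof.
pose F (a : {ffun 'I_d -> 'I_(K.*2.+1)}) : {poly int} :=
  'X^d + \poly_(i < d) (if insub i is Some j then (a j : nat)%:Z - K%:Z else 0).
apply: (@sub_finite_set _ _ (F @` setT)); last exact/finite_image/finite_finset.
move=> f [/monicP fm sf _ fK].
exists [ffun j : 'I_d => inord (absz (f`_j + K%:Z))] => //.
apply/polyP => i; rewrite coefD coefXn coef_poly.
case: (ltngtP i d) => [lid|ldi|->].
- rewrite add0r insubT ffunE /= inordK.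
    have /andP[h1 h2] := fK _ lid.
    by rewrite gez0_abs ?addrK// -lerBlDr sub0r.
  have /andP[h1 h2] := fK _ lid.
  rewrite ltnS -lez_nat gez0_abs; last by rewrite -lerBlDr sub0r.
  by rewrite -addnn PoszD lerD2r.
- by rewrite addr0 nth_default// sf.
- by move: fm; rewrite lead_coefE sf addr0.
Qed.

Definition log2 (R : realType) (x : R) : R := ln x / ln 2.

(* Main.v *)
Require Import Defs.
From HB Require Import structures.
From mathcomp Require Import all_boot all_order all_algebra.
From mathcomp Require Import finmap zify ring.
From mathcomp Require Import all_classical all_reals all_analysis.
Import Order.TTheory GRing.Theory Num.Theory.
Import numFieldNormedType.Exports.
Local Open Scope classical_set_scope.
Local Open Scope ring_scope.

(** A reducible monic polynomial of degree [d] is a product [f = g * h] of two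
monic integer polynomials of positive degree, and [f] is recovered from the
residues of [g] and [h] modulo [N = 2K + 1]: the coefficients of [f] lie in
[[-K, K]], a complete system of residues modulo [N].  Writing [balanced_poly]
for coefficientwise reduction into that system, this reads
[f = balanced_poly (balanced_poly g * balanced_poly h)].

So reducible polynomials can be counted through pairs of reduced factors.  For
given degrees of [g] and [h] there are [N ^ (d - 2)] choices for the
coefficients that are neither leading nor constant.  The constant terms
[b = g(0)] and [c = h(0)] are nonzero with [|b * c| <= K], since [b * c = f(0)];
the divisor sum bounds the number of such pairs by [4 * K * (L + 1)], where
[L] is the binary logarithm of [K] rounded down.  In total there are at most
[4 * (d - 1) * (L + 1) * K * N ^ (d - 2)] reducible polynomials
([reducible_coverP], [size_reducible_cover]), against at least
[K * N ^ (d - 1)] polynomials altogether ([card_calP_ge]).  The proportion of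
reducible ones is therefore at most [4 * (d - 1) * (L + 1) / N].

The relation between [d] and [K] gives [2 ^ d <= K], that is [d <= L].  As
[N > 2 ^ (L + 1)], the proportion is then of order [L ^ 2 / 2 ^ L = O(1 / d)],
which gives [uniform_Pr_irreducible_ge], and the limit follows by squeezing. *)

(** * Splitting a reducible polynomial into two monic factors *)

(** Some factor of a nontrivial product is nonconstant, and the product of the
remaining ones is then nonconstant too, for degree reasons.  Both leading
coefficients are the same unit of the integers, which scaling removes. *)
Lemma monic_factor_pair {f : {poly int}} :
  f \is monic -> (1 < size f)%N -> ~ int_irreducible f ->
  exists g h : {poly int},
    [/\ g \is monic, h \is monic, (1 < size g)%N, (1 < size h)%N & f = g * h].
Proof.
move=> fm f1 /contrapT[s [_ sf fE]].
have [g gs g1] : exists2 g, g \in s & (1 < size g)%N.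
  apply: contrapT => nog; move: f1; rewrite ltnNge => /negP; apply.
  rewrite fE big_seq; elim/big_ind: _ => [|x y x1 y1|x xs].
  - by rewrite size_poly1.
  - by rewrite (leq_trans (size_polyMleq x y))//; lia.
  - by rewrite leqNgt; apply/negP => x1; apply: nog; exists x.
have {}fE : f = g * \prod_(p <- rem g s) p by rewrite fE (big_rem _ gs).
set h := \prod_(_ <- _) _ in fE.
have lgh : lead_coef g * lead_coef h = 1 by rewrite -lead_coefM -fE (monicP fm).
have lhg : lead_coef h * lead_coef g = 1 by rewrite mulrC.
have lg0 : lead_coef g != 0 by apply/eqP => l0; move: lgh; rewrite l0 mul0r.
have lh0 : lead_coef h != 0 by apply/eqP => l0; move: lhg; rewrite l0 mul0r.
exists (lead_coef h *: g), (lead_coef g *: h); split.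
- by rewrite monicE lead_coefZ lhg.
- by rewrite monicE lead_coefZ lgh.
- by rewrite size_scale.
- have := sf _ gs; rewrite size_scale// fE size_mul//; last 2 first.
  + by rewrite -lead_coef_eq0.
  + by rewrite -lead_coef_eq0.
  by rewrite ltn_predRL -addn1 ltn_add2l.
- by rewrite -scalerAl -scalerAr scalerA lhg scale1r.
Qed.

(** * Balanced residues modulo 2K + 1 *)

Definition balanced (K : nat) (x : int) : int :=
  ((x + K%:Z) %% K.*2.+1%:Z)%Z - K%:Z.

Definition balanced_poly (K : nat) (f : {poly int}) : {poly int} :=
  map_poly (balanced K) f.

Lemma balanced_bounds K x : - K%:Z <= balanced K x <= K%:Z.
Proof. by rewrite /balanced; lia. Qed.

Lemma balanced_id K x : - K%:Z <= x <= K%:Z -> balanced K x = x.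
Proof. by move=> xK; rewrite /balanced modz_small ?addrK//; lia. Qed.

Lemma balancedDM K x y : balanced K (x + K.*2.+1%:Z * y) = balanced K x.
Proof. by rewrite /balanced mulrC [x + _]addrC -[_ + x + _]addrA modzMDl. Qed.

Lemma balanced0 K : balanced K 0 = 0.
Proof. by rewrite balanced_id//; lia. Qed.

Lemma coef_balanced_poly K f i : (balanced_poly K f)`_i = balanced K f`_i.
Proof. by rewrite coef_map_id0// balanced0. Qed.

Lemma balanced_polyE K f :
  exists q, balanced_poly K f = f + K.*2.+1%:Z *: q.
Proof.
exists (map_poly (fun x => - ((x + K%:Z) %/ K.*2.+1%:Z)%Z) f).
apply/polyP => i; rewrite coefD coefZ coef_balanced_poly coef_map_id0.
  rewrite /balanced; move: (divz_eq (f`_i + K%:Z) K.*2.+1%:Z).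
  set q := divz _ _; set r := modz _ _; move/(canRL (addrK _)) => ->.
  by ring.
by rewrite add0r divz_small//; lia.
Qed.

Lemma balanced_polyDZ K f q :
  balanced_poly K (f + K.*2.+1%:Z *: q) = balanced_poly K f.
Proof.
by apply/polyP => i; rewrite !coef_balanced_poly coefD coefZ balancedDM.
Qed.

(** Reduction changes a polynomial by a multiple of [2K + 1], and such multiples
absorb products.  This is what recovers a product from its reduced factors. *)
Lemma balanced_polyM K g h :
  balanced_poly K (balanced_poly K g * balanced_poly K h) =
  balanced_poly K (g * h).
Proof.
have [p ->] := balanced_polyE K g; have [q ->] := balanced_polyE K h.
rewrite mulrDl !mulrDr -!scalerAl -!scalerAr -addrA -!scalerDr.
exact: balanced_polyDZ.
Qed.

(** * Enumerating monic polynomials with coefficients in a box *)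

Fixpoint words {T : Type} (A : seq T) (n : nat) : seq (seq T) :=
  if n is m.+1 then [seq a :: w | a <- A, w <- words A m] else [:: [::]].

Lemma size_words (T : Type) (A : seq T) n : size (words A n) = (size A ^ n)%N.
Proof. by elim: n => //= n IH; rewrite size_allpairs IH expnS. Qed.

Lemma mem_words (T : eqType) (A : seq T) n w :
  (w \in words A n) = (size w == n) && all (mem A) w.
Proof.
elim: n w => [|n IH] [|a w] //=.
  by apply/allpairsP => -[[? ?] [_ _]].
rewrite eqSS andbCA -IH; apply/allpairsP/andP => [[[b v] [/= ? ? [-> ->]]]//|].
by move=> [aA wA]; exists (a, w).
Qed.

Lemma uniq_words (T : eqType) (A : seq T) n : uniq A -> uniq (words A n).
Proof.
move=> uA; elim: n => //= n IH; rewrite allpairs_uniq//.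
by move=> [a v] [b w] _ _ /= [-> ->].
Qed.

Definition box (K : nat) : seq int := [seq i%:Z - K%:Z | i <- iota 0 K.*2.+1].

Lemma size_box K : size (box K) = K.*2.+1.
Proof. by rewrite size_map size_iota. Qed.

Lemma mem_box K x : (x \in box K) = (- K%:Z <= x <= K%:Z).
Proof.
apply/mapP/idP => [[i]|xK]; first by rewrite mem_iota; lia.
by exists (absz (x + K%:Z)); rewrite ?mem_iota; lia.
Qed.

Lemma uniq_box K : uniq (box K).
Proof. by rewrite map_inj_uniq ?iota_uniq// => i j; lia. Qed.

(** The constant term is kept apart from the other coefficients because it is
the only one subject to a constraint beyond lying in the box. *)
Definition monic_of (b : int) (w : seq int) : {poly int} :=
  Poly (b :: rcons w 1).

Lemma polyseq_monic_of b w : monic_of b w = b :: rcons w 1 :> seq int.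
Proof. by rewrite (@PolyK _ 0)//= last_rcons. Qed.

Lemma monic_of_inj b c v w :
  monic_of b v = monic_of c w -> b = c /\ v = w.
Proof.
move=> /(congr1 (@polyseq _)); rewrite !polyseq_monic_of => -[->].
by move=> /rcons_inj[->].
Qed.

Lemma monic_ofP {f : {poly int}} {n} : f \is monic -> size f = n.+2 ->
  exists2 w, size w = n & f = monic_of f`_0 w.
Proof.
move=> /monicP; rewrite lead_coefE => + sf; rewrite sf/= => fn.
exists (mkseq (fun i => f`_i.+1) n); first by rewrite size_mkseq.
apply/polyP => -[|i]; rewrite coef_Poly//= nth_rcons size_mkseq.
by case: ltngtP => [?|?|->]//; rewrite ?nth_mkseq// nth_default// sf.
Qed.

Lemma monic_of_calP K b w :
  b != 0 -> - K%:Z <= b <= K%:Z -> all (mem (box K)) w ->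
  monic_of b w \in calP (size w).+1 K.
Proof.
move=> b0 bK /allP wK.
rewrite inE /calP/= monicE lead_coefE polyseq_monic_of/= size_rcons.
rewrite -[X in X == 1]/((rcons w 1)`_(size w)) nth_rcons ltnn !eqxx.
split=> // -[|i] // iw; rewrite /= nth_rcons (iw : (i < _)%N).
by rewrite -mem_box; apply/wK/mem_nth.
Qed.

Lemma balanced_polyP {K} {g : {poly int}} {n} :
  (0 < K)%N -> g \is monic -> size g = n.+2 ->
  exists2 w, w \in words (box K) n &
    balanced_poly K g = monic_of (balanced K g`_0) w.
Proof.
move=> K0 /monicP gm sg.
have b1 : balanced K 1 = 1 by rewrite balanced_id//; lia.
have sb : size (balanced_poly K g) = n.+2.
  by rewrite size_map_poly_id0// gm b1.
have bm : balanced_poly K g \is monic.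
  by rewrite monicE lead_coef_map_id0 ?gm ?b1// balanced0.
have [w sw bE] := monic_ofP bm sb.
exists w; last by rewrite {1}bE coef_balanced_poly.
rewrite mem_words sw eqxx/=; apply/(all_nthP 0) => i iw /=.
have -> : w`_i = (balanced_poly K g)`_i.+1.
  by rewrite bE polyseq_monic_of/= nth_rcons iw.
by rewrite mem_box coef_balanced_poly balanced_bounds.
Qed.

(** * Counting the constant terms of the factors *)

Definition hyperbola (K : nat) : seq (nat * nat) :=
  [seq (u, v) | u <- iota 1 K, v <- iota 1 (K %/ u)].

Lemma mem_hyperbola K u v :
  (0 < u)%N -> (0 < v)%N -> (u * v <= K)%N -> (u, v) \in hyperbola K.
Proof.
move=> u0 v0 uvK; apply/allpairsPdep; exists u, v.
by rewrite !mem_iota !add1n !ltnS u0 v0 leq_divRL// mulnC uvK; split=> //; nia.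
Qed.

(** Each of the [n] dyadic blocks [2 ^ j <= u < 2 ^ j.+1] has [2 ^ j] terms, all
at most [K %/ 2 ^ j], hence contributes at most [K]. *)
Lemma sum_divn_le K n : (\sum_(1 <= u < 2 ^ n) K %/ u <= n * K)%N.
Proof.
elim: n => [|n IH]; first by rewrite big_geq.
have n0 : (0 < 2 ^ n)%N by rewrite expn_gt0.
have n1 : (2 ^ n <= 2 ^ n.+1)%N by rewrite leq_exp2l.
rewrite (big_cat_nat _ n1)//= mulSnr leq_add//.
rewrite (@leq_trans (\sum_(2 ^ n <= u < 2 ^ n.+1) K %/ 2 ^ n))//.
  rewrite big_seq [leqRHS]big_seq; apply: leq_sum => u.
  by rewrite mem_index_iota => /andP[nu _]; exact: leq_div2l.
rewrite sum_nat_const_nat expnS mul2n -addnn addnK mulnC.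
exact: leq_divM.
Qed.

Lemma size_hyperbola {K} : (0 < K)%N ->
  (size (hyperbola K) <= (trunc_log 2 K).+1 * K)%N.
Proof.
move=> K0; apply: leq_trans (sum_divn_le K _).
rewrite size_allpairs_dep sumnE big_map.
under eq_bigr do rewrite size_iota.
have -> : iota 1 K = index_iota 1 K.+1 by rewrite /index_iota subn1.
have KL : (K.+1 <= 2 ^ (trunc_log 2 K).+1)%N by rewrite trunc_log_ltn.
by rewrite [leqRHS](big_cat_nat _ KL)//= leq_addr.
Qed.

Definition const_pairs (K : nat) : seq (int * int) :=
  [seq (s.1 * uv.1%:Z, s.2 * uv.2%:Z)
  | s <- [:: (1, 1); (1, -1); (-1, 1); (-1, -1)], uv <- hyperbola K].

Lemma mem_const_pairs K (b c : int) :
  b != 0 -> c != 0 -> `|b * c| <= K%:Z -> (b, c) \in const_pairs K.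
Proof.
move=> b0 c0 bcK; apply/allpairsP.
exists (((-1) ^+ (b < 0)%R, (-1) ^+ (c < 0)%R), (absz b, absz c)); split => /=.
- by case: (b < 0); case: (c < 0).
- by apply: mem_hyperbola; lia.
- by rewrite -!intEsign.
Qed.

Lemma size_const_pairs {K} : (0 < K)%N ->
  (size (const_pairs K) <= 4 * ((trunc_log 2 K).+1 * K))%N.
Proof. by move=> K0; rewrite size_allpairs leq_mul2l/= size_hyperbola. Qed.

(** * Counting reducible polynomials *)

(** The factors have degrees [j + 1] and [e - j + 1].  A single word of length
[e] holds the middle coefficients of both and is cut at [j], so that the number
of words does not depend on [j]. *)
Definition reducible_cover (e K : nat) : seq {poly int} :=
  [seq balanced_poly K (monic_of p.1.1 (take j p.2) * monic_of p.1.2 (drop j p.2))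
  | j <- iota 0 e.+1,
    p <- [seq (bc, w) | bc <- const_pairs K, w <- words (box K) e]].

Lemma size_reducible_cover e K : (0 < K)%N ->
  (size (reducible_cover e K) <=
   e.+1 * (4 * ((trunc_log 2 K).+1 * K) * K.*2.+1 ^ e))%N.
Proof.
move=> K0; rewrite /reducible_cover.
move: (const_pairs K) (size_const_pairs K0) => s sK.
rewrite !size_allpairs size_iota size_words size_box.
by rewrite leq_mul2l/= leq_mul2r sK orbT.
Qed.

Lemma calP_gt0 {d K f} : calP d.+1 K f -> (0 < K)%N.
Proof. by move=> [_ _ f0 /(_ 0%N isT)]; lia. Qed.

Lemma normz_leM {b : int} (c : int) : b != 0 -> `|c| <= `|b * c|.
Proof. by move=> b0; rewrite normrM ler_peMl//; lia. Qed.

(** The constant terms divide [f(0)], so they already lie in the box and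
reduction leaves them unchanged: the reduced factors still satisfy the
hyperbola constraint. *)
Lemma reducible_coverP e K f :
  calP e.+2 K f -> ~ int_irreducible f -> f \in reducible_cover e K.
Proof.
move=> fP fred; have K0 := calP_gt0 fP.
have [fm sf f0 fK] := fP.
have [|g [h [gm hm g1 h1 fE]]] := monic_factor_pair fm _ fred; rewrite ?sf//.
have [i sg] : exists i, size g = i.+2.
  by exists (size g).-2; case: (size g) g1 => [|[]].
have [k sh] : exists k, size h = k.+2.
  by exists (size h).-2; case: (size h) h1 => [|[]].
have ike : (i + k = e)%N.
  by move: sf; rewrite fE size_monicM ?monic_neq0// sg sh; lia.
have f0E : f`_0 = g`_0 * h`_0 by rewrite fE coef0M.
have g0 : g`_0 != 0 by apply/eqP => g0; move: f0; rewrite f0E g0 mul0r eqxx.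
have h0 : h`_0 != 0 by apply/eqP => h0; move: f0; rewrite f0E h0 mulr0 eqxx.
have ghK : `|g`_0 * h`_0| <= K%:Z.
  by rewrite -f0E; move: (fK 0%N isT); rewrite -ler_norml.
have [v vP gE] := balanced_polyP K0 gm sg.
have [w wP hE] := balanced_polyP K0 hm sh.
have gK : `|g`_0| <= K%:Z by apply: le_trans ghK; rewrite mulrC normz_leM.
have hK := le_trans (normz_leM h`_0 g0) ghK.
move: gE hE; rewrite !balanced_id -?ler_norml// => gE hE.
have sv : size v = i by move: vP; rewrite mem_words => /andP[/eqP].
apply/allpairsP; exists (i, ((g`_0, h`_0), v ++ w)); split => /=.
- by rewrite (mem_iota 0 e.+1); lia.
- apply/allpairsP; exists ((g`_0, h`_0), v ++ w); split => //=.
    exact: mem_const_pairs.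
  move: vP wP; rewrite !mem_words size_cat all_cat.
  by move=> /andP[/eqP-> ->] /andP[/eqP-> ->]; rewrite ike eqxx.
- rewrite take_size_cat// drop_size_cat// -gE -hE balanced_polyM -fE.
  apply/polyP => j; rewrite coef_balanced_poly balanced_id//.
  have [/fK//|] := ltnP j e.+2; rewrite leq_eqVlt => /predU1P[<-|ej].
    by have := monicP fm; rewrite lead_coefE sf/= => ->; lia.
  by rewrite nth_default ?sf//; lia.
Qed.

(** Polynomials with a positive constant term are enough for a lower bound of the
right order. *)
Lemma card_calP_ge e K :
  (K * K.*2.+1 ^ e <= #|` fset_set (calP e.+1 K)|)%N.
Proof.
pose s := [seq monic_of u%:Z w | u <- iota 1 K, w <- words (box K) e].
have -> : (K * K.*2.+1 ^ e)%N = size s.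
  by rewrite size_allpairs size_iota size_words size_box.
apply: uniq_leq_size.
  apply: allpairs_uniq; rewrite ?iota_uniq ?uniq_words ?uniq_box//.
  by move=> [u v] [u' w] _ _ /= /monic_of_inj[[->] ->].
move=> f /allpairsP[[u w] [/= uK wP ->]].
rewrite in_fset_set; last exact: finite_calP.
move: wP uK; rewrite mem_words mem_iota => /andP[/eqP <- wP] uK.
by apply: monic_of_calP => //; lia.
Qed.

Lemma card_calP_le {e K} : (0 < K)%N ->
  (#|` fset_set (calP e.+2 K)| <=
   #|` fset_set (calP e.+2 K `&` int_irreducible)| +
   e.+1 * (4 * ((trunc_log 2 K).+1 * K) * K.*2.+1 ^ e))%N.
Proof.
move=> K0; apply: (@leq_trans (size (fset_set (calP e.+2 K `&` int_irreducible)
                         ++ reducible_cover e K))); last first.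
  by rewrite size_cat leq_add2l size_reducible_cover.
apply: uniq_leq_size; first exact: fset_uniq.
move=> f; rewrite in_fset_set ?inE; last exact: finite_calP.
move=> fP; rewrite mem_cat in_fset_set; last first.
  by apply: finite_setIl; exact: finite_calP.
have [fi|fr] := pselect (int_irreducible f); first by rewrite mem_set.
by rewrite reducible_coverP ?orbT.
Qed.

(** * The probability of being irreducible *)

Lemma cube_le_expn n : (n ^ 3 <= 8 * 2 ^ n)%N.
Proof.
have [n4|] := leqP n 3; first by case: n n4 => [|[|[|[|]]]].
elim: n => // n IH; rewrite ltnS leq_eqVlt => /predU1P[<-//|n3].
by have := IH n3; rewrite !expnS !expn0; nia.
Qed.

(** With [d <= L] and [2 ^ L <= K], where [L] is the integral part of the binary
logarithm of [K], the product [d * (d - 1) * (L + 1)] is at most [L ^ 3], which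
is at most [8 * 2 ^ L <= 4 * N]. *)
Lemma card_reducible_le {d K} : (1 < d)%N -> (2 ^ d <= K)%N ->
  (d * #|` fset_set (calP d K)| <=
   d * #|` fset_set (calP d K `&` int_irreducible)| +
   16 * #|` fset_set (calP d K)|)%N.
Proof.
case: d => [|[|e]]// _ dK; set L := trunc_log 2 K.
have K0 : (0 < K)%N by rewrite (leq_trans _ dK)// expn_gt0.
have dL : (e.+2 <= L)%N by rewrite trunc_log_max.
have LK : (2 ^ L <= K)%N by rewrite trunc_logP.
have := card_calP_le (e := e) K0; have := card_calP_ge e.+1 K; rewrite -/L.
move: (#|` _|) => P; move: (#|` _|) => I.
set N := K.*2.+1; rewrite expnS; set M := (N ^ e)%N => KP PI.
have L3 : (e.+2 * e.+1 * L.+1 <= 4 * N)%N.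
  have := cube_le_expn L; rewrite !expnS expn0 /N; nia.
rewrite (leq_trans (leq_mul (leqnn e.+2) PI))// mulnDr leq_add2l.
apply: (@leq_trans (16 * (K * (N * M)))%N); last by rewrite leq_mul2l KP.
have -> : (e.+2 * (e.+1 * (4 * (L.+1 * K) * M)) =
  e.+2 * e.+1 * L.+1 * (4 * K * M))%N by lia.
by rewrite (leq_trans (leq_mul L3 (leqnn _)))//; lia.
Qed.

Lemma uniform_Pr_irreducible_ge (R : realType) d K :
  (1 < d)%N -> (2 ^ d <= K)%N ->
  1 - 16 / d%:R <= uniform_Pr R (calP d K) int_irreducible.
Proof.
move=> d1 dK; have d0 : 0 < d%:R :> R by rewrite ltr0n; lia.
have := card_reducible_le d1 dK; rewrite /uniform_Pr.
have : (0 < #|` fset_set (calP d K)|)%N.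
  case: d d1 dK {d0} => // e _ dK; apply: leq_trans (card_calP_ge e K).
  by rewrite muln_gt0 expn_gt0/= andbT (leq_trans _ dK)// expn_gt0.
move: (#|` _|) => P; move: (#|` _|) => I P0.
rewrite -(ler_nat R) natrD !natrM => PI.
have {}P0 : 0 < P%:R :> R by rewrite ltr0n.
rewrite ler_pdivlMr// mulrBl mul1r lerBlDr -(ler_pM2l d0) mulrDr.
by rewrite [d%:R * (_ * P%:R)]mulrA [d%:R * (16 / _)]mulrC divfK ?gt_eqF.
Qed.

Lemma uniform_Pr_le1 (R : realType) (T : choiceType) (A B : set T) :
  finite_set A -> uniform_Pr R A B <= 1.
Proof.
move=> fA; rewrite /uniform_Pr.
have AB : (#|` fset_set (A `&` B)| <= #|` fset_set A|)%N.
  apply: fsubset_leq_card; apply/fsubsetP => x.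
  rewrite !in_fset_set//; last exact: finite_setIl.
  by rewrite !inE => -[].
have [->|A0] := eqVneq #|` fset_set A| 0%N; first by rewrite invr0 mulr0.
by rewrite ler_pdivrMr ?mul1r ?ler_nat// ltr0n lt0n.
Qed.

(** The subtracted logarithm is nonnegative, so [d] is at most [log2 K].  The
condition [0 < d] excludes [K = 0], where [ln] takes its default value 0. *)
Lemma expn_le_of_log2 (R : realType) d K : (0 < d)%N ->
  d%:R <= log2 (K%:R : R) - log2 (1 + ln (K%:R : R) ^+ 2) -> (2 ^ d <= K)%N.
Proof.
move=> d0 dK.
have ln2 : 0 < ln 2 :> R by rewrite ln_gt0// ltr1n.
have : d%:R <= log2 (K%:R : R).
  apply: le_trans dK _; rewrite gerBl /log2 divr_ge0 ?(ltW ln2)// ln_ge0//.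
  by rewrite lerDl sqr_ge0.
rewrite /log2 ler_pdivlMr// mulr_natl -lnXn// => dlnK.
have K0 : (0 < K)%N.
  rewrite lt0n; apply: contraTneq dlnK => ->.
  by rewrite -ltNge [ltLHS]ln0// lnXn// pmulrn_rgt0.
by move: dlnK; rewrite ler_ln ?posrE ?exprn_gt0 ?ltr0n// -natrX ler_nat.
Qed.

Theorem theorem4p1 (R : realType) :
  uniform_Pr R (calP dK.1 dK.2) int_irreducible
    @[dK --> within
        [set dK : nat * nat |
          dK.1%:R <= log2 (dK.2%:R : R) - log2 (1 + ln (dK.2%:R : R) ^+ 2)]
        (filter_prod \oo \oo)] --> (1 : R).
Proof.
apply: (@squeeze_cvgr _ _ _ _ (fun dK => 1 - 16 / dK.1%:R) (fun=> 1)).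
- near=> dK.
  have d1 : (1 < dK.1)%N.
    near: dK; apply: cvg_within.
    exists ([set d | (1 < d)%N], setT) => [|[? ?] []//].
    by split => //=; [exact: nbhs_infty_gt|exact: filterT].
  rewrite uniform_Pr_le1 ?andbT; last exact: finite_calP.
  apply: uniform_Pr_irreducible_ge => //; apply: (@expn_le_of_log2 R).
    exact: ltnW.
  by near: dK; exact: withinT.
- have lim16 : (1 - 16 / d%:R : R) @[d --> \oo] --> (1 : R).
    rewrite -[X in _ --> X]subr0 -[X in _ - X](mulr0 16).
    apply: cvgB; first exact: cvg_cst.
    apply: cvgM; first exact: cvg_cst.
    apply/gtr0_cvgV0; last exact: cvgr_idn.
    by near=> n; rewrite ltr0n; near: n; exact: nbhs_infty_gt.
  have := cvg_comp _ _ _ lim16; apply.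
  by move=> A /= h; apply: cvg_within; exact: cvg_fst.
- exact: cvg_cst.
Unshelve. all: by end_near. Qed.
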